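(* Let $n,p$ be integers with $2\leq p\leq n-1$ and let $\beta>2$. Then the length $\ell_\beta$ of a shortest geodesic loop on the Stiefel manifold $\mathrm{St}_\beta(n,p)$ is $\ell_\beta=2\pi$.
   Context: For integers $1\le p\le n$, $\mathrm{St}(n,p)=\{U\in\mathbb{R}^{n\times p} : U^\top U=I_p\}$, with tangent spaces $T_U\mathrm{St}(n,p)=\{\Delta\in\mathbb{R}^{n\times p} : U^\top\Delta \text{ is skew-symmetric}\}$. Any $\Delta\in T_U\mathrm{St}(n,p)$ is written $\Delta=UA+U_\perp B$ with $A=U^\top\Delta\in\mathrm{Skew}(p)$ (the real skew-symmetric $p\times p$ matrices), $B\in\mathbb{R}^{(n-p)\times p}$ and $[U\ U_\perp]\in\mathrm{O}(n)$. For $\beta>0$, the $\beta$-metric is $\langle\Delta_1,\Delta_2\rangle_\beta=\beta\,\mathrm{tr}(A_1^\top A_2)+\mathrm{tr}(B_1^\top B_2)$, and $\mathrm{St}_\beta(n,p)$ denotes $\mathrm{St}(n,p)$ with this Riemannian metric. With $I_{n\times p}=[I_p\ 0]^\top$, the geodesic from $I_{n\times p}$ with initial velocity $\begin{bmatrix}A\\ B\end{bmatrix}$ is $\gamma_\beta(t)=\exp_{\mathrm m}\left(t\begin{bmatrix}2\beta A&-B^\top\\ B&0\end{bmatrix}\right)I_{n\times p}\exp_{\mathrm m}(t(1-2\beta)A)$, where $\exp_{\mathrm m}$ is the matrix exponential. Length means Riemannian length in the $\beta$-metric. A geodesic loop is a nonconstant geodesic segment that begins and ends at the same point (no condition on the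 velocities at the endpoints). $\ell_\beta$ is the minimal length of geodesic loops; since $\mathrm{St}_\beta(n,p)$ is homogeneous, the starting point may be taken to be $I_{n\times p}$. *)

(* Defs.v *)
From HB Require Import structures.
From mathcomp Require Import all_boot all_order all_algebra.
From mathcomp Require Import all_classical all_reals all_analysis.

Set Implicit Arguments.
Unset Strict Implicit.
Unset Printing Implicit Defensive.

Import Order.TTheory GRing.Theory Num.Theory.
Import numFieldNormedType.Exports.

Local Open Scope classical_set_scope.
Local Open Scope ring_scope.

(* Throughout, St(n, p) is handled with n = p + q, so that [U Uperp] and the
   n x n block matrix in the geodesic formula are plain block matrices. *)

Section Stiefel.
Variable R : realType.

Definition exp_mx (m : nat) (X : 'M[R]_m) : 'M[R]_m :=
  limn (series (fun k : nat => (k`!%:R)^-1 *: X ^+ k)).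

Definition orthogonal_mx (m : nat) (Q : 'M[R]_m) : Prop := Q^T *m Q = 1%:M.

Definition skew_mx (m : nat) (A : 'M[R]_m) : Prop := A^T = - A.

Variables p q : nat.
Implicit Types (U D : 'M[R]_(p + q, p)) (V : 'M[R]_(p + q, q)).
Implicit Types (A : 'M[R]_p) (B : 'M[R]_(q, p)).

Definition stiefel : set 'M[R]_(p + q, p) := [set U | U^T *m U = 1%:M].

Definition tangent U : set 'M[R]_(p + q, p) := [set D | skew_mx (U^T *m D)].

Definition completes U V : Prop := orthogonal_mx (row_mx U V).

(* A completion Uperp of U, chosen classically; beta_metric does not depend on
   this choice, see beta_metricE. *)
Definition perp U : 'M[R]_(p + q, q) := xget 0 [set V | completes U V].

(* For D tangent at U, the components of D = U A + Uperp B are A = U^T D and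
   B = Uperp^T D. *)
Definition beta_metric (beta : R) U D1 D2 : R :=
  beta * \tr ((U^T *m D1)^T *m (U^T *m D2))
  + \tr (((perp U)^T *m D1)^T *m ((perp U)^T *m D2)).

Definition Inp : 'M[R]_(p + q, p) := col_mx 1%:M 0.

Definition geodesic_at_Inp (beta : R) A B (t : R) : 'M[R]_(p + q, p) :=
  exp_mx (t *: block_mx ((2 * beta) *: A) (- B^T) B 0) *m Inp
  *m exp_mx ((t * (1 - 2 * beta)) *: A).

(* g is the geodesic with g 0 = U and g'(0) = D. Left multiplication by the
   orthogonal matrix [U V] is an isometry taking Inp to U and the velocity
   [A; B] to U A + V B = D. *)
Definition is_geodesic (beta : R) U D (g : R -> 'M[R]_(p + q, p)) : Prop :=
  [/\ stiefel U, tangent U D &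
      exists2 V, completes U V &
        g = fun t => row_mx U V *m geodesic_at_Inp beta (U^T *m D) (V^T *m D) t].

(* The segment is g restricted to [0, T]. *)
Definition geodesic_loop (beta : R) (g : R -> 'M[R]_(p + q, p)) (T : R) : Prop :=
  [/\ exists U D, is_geodesic beta U D g,
      0 < T,
      exists2 t : R, t \in `[0, T] & g t != g 0 &
      g T = g 0].

Definition speed (beta : R) (g : R -> 'M[R]_(p + q, p)) (t : R) : R :=
  Num.sqrt (beta_metric beta (g t) (derive1 g t) (derive1 g t)).

Definition riemannian_length (beta : R) (g : R -> 'M[R]_(p + q, p)) (T : R) : R :=
  (\int[lebesgue_measure]_(t in `[0, T]) speed beta g t)%R.

Definition geodesic_loop_lengths (beta : R) : set R :=
  [set l | exists g T, geodesic_loop beta g T /\ l = riemannian_length beta g T].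

Definition is_shortest_loop_length (beta l : R) : Prop :=
  geodesic_loop_lengths beta l /\
  forall l', geodesic_loop_lengths beta l' -> l <= l'.

Lemma completesE U V V' : completes U V -> completes U V' ->
  V *m V^T = V' *m V'^T.
Proof.
have H W : completes U W -> U *m U^T + W *m W^T = 1%:M.
  by move=> /mulmx1C; rewrite tr_row_mx mul_row_col.
by move=> /H hV /H hV'; apply: (@addrI _ (U *m U^T)); rewrite hV hV'.
Qed.

Lemma beta_metricE (beta : R) U V D1 D2 : completes U V ->
  beta_metric beta U D1 D2 =
  beta * \tr ((U^T *m D1)^T *m (U^T *m D2))
  + \tr ((V^T *m D1)^T *m (V^T *m D2)).
Proof.
move=> UV; rewrite /beta_metric; congr (_ + \tr _).
have UP : completes U (perp U) by apply: xgetPex; exists V.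
rewrite !trmx_mul !trmxK -!mulmxA; congr (_ *m _).
by rewrite !mulmxA (completesE UP UV).
Qed.

End Stiefel.

Arguments is_shortest_loop_length {R} p q beta l.

(* Main.v *)
Require Import Defs.
From mathcomp Require Import all_boot all_order all_algebra.
From mathcomp Require Import all_classical all_reals all_analysis.
From mathcomp Require Import complex ring lra zify.
Import Order.TTheory GRing.Theory Num.Theory.
Import numFieldNormedType.Exports.

(** A geodesic with initial velocity [A; B] has constant speed, the square root
    of beta |A|^2 + |B|^2, so that after rescaling time a loop is a pair (A, B),
    not zero, for which the geodesic closes up at time 1, and its squared length
    is beta |A|^2 + |B|^2. Put X = [2 beta A, - B^T; B, 0], Y = (2 beta - 1) A and
    k = 1 / (2 beta - 1). The loop closes up when exp X maps the first p basis
    vectors as exp Y does; as exp X is orthogonal, it is then block diagonal with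
    first block exp Y and some second block Q.

    Let 2 pi i h_j be the eigenvalues of X and 2 pi i y_v those of Y. The squared
    length is 2 pi^2 (sum_j h_j^2 - (1 + k) sum_v y_v^2), and the claim becomes the
    inequality sum_j h_j^2 >= 2 + (1 + k) sum_v y_v^2 ([lattice_gap]). Two facts
    link the h_j to the y_v ([closed_geodesic_energy]). Compare an orthonormal
    eigenbasis of X with one of exp X adapted to the two blocks: the squared
    moduli of the scalar products form a doubly stochastic matrix whose nonzero
    entries relate numbers that are congruent modulo 1, because both bases
    diagonalize exp X. And the diagonal blocks of X, which are (1 + k) Y and 0,
    prescribe the weighted means of the h_j: (1 + k) y_v for an eigenvector of Y
    and 0 for an eigenvector of Q.

    For the inequality, write x = f + n with n the integral part of x; then
    x^2 = (2 f - 1) x + f (1 - f) + n (n + 1). The coefficients that depend on f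
    are constant along each row of weights, so the first two terms are transported
    by the weights ([periodic_trace]), and Jensen's inequality handles the convex
    function n (n + 1). Integrality gives the constant: the sum of the
    positive parts of the integral parts of the h_j is an integer exceeding
    strictly the analogous sum for the y_v, hence exceeding it by 1, as soon as
    some y_v is positive; the same holds for negative parts
    ([integral_gain]). Since Y is skew its eigenvalues sum to zero, and either both
    cases occur or A = 0. In the latter case the integers among the h_j sum
    to zero and are not all zero, so their squares sum to at least 2.

    Equality is attained by A = 0 and B = 2 pi times a matrix unit, for which the
    geodesic is a full rotation of a plane ([geodesic_loop_2pi]).

    The spectral decomposition of real skew matrices over the complex numbers
    also computes their exponentials, entry by entry, from the cosine
    and sine series ([exp_mx_spectrum]); derivatives and speeds of geodesics follow
    ([is_derive_exp], [speed_geodesic]). *)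

Set Implicit Arguments.
Unset Strict Implicit.
Unset Printing Implicit Defensive.

Local Open Scope classical_set_scope.
Local Open Scope ring_scope.
Local Open Scope sesquilinear_scope.

(** * Doubly stochastic weights between points congruent modulo 1 *)

Section Lattice.
Variable R : realType.

Local Notation fl x := (Num.floor (x : R)).
Definition frac (x : R) : R := x - (fl x)%:~R.

Lemma frac_bounds (x : R) : 0 <= frac x < 1.
Proof.
have /andP[h1 h2] := Num.Theory.floor_itv x.
by rewrite /frac; move: h2; rewrite intrD; lra.
Qed.

Lemma frac_congr (x y : R) : x - y \is a Num.int ->
  frac x = frac y.
Proof.
move=> /intrP[m e].
have -> : x = y + m%:~R by rewrite -e; lra.
by rewrite /frac floorDrz ?intr_int// intrKfloor intrD; lra.
Qed.

(** In the application [h j] and [y v] are the frequencies, in turns, of a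
    skew matrix and of its rescaled corner, and [a], [b] are the squared moduli
    of the matrix that passes from an eigenbasis of the first to a
    block-diagonal eigenbasis of its exponential. Since only exponentials are
    compared, a weight can be nonzero only between frequencies that agree
    modulo 1. The corner is distorted by the factor [1 + k], and the
    complementary corner vanishes: this is what the two mean values say. *)
Variables (J V W : finType) (a : V -> J -> R) (b : W -> J -> R).
Variables (h : J -> R) (y : V -> R) (k : R).
Hypotheses (a_ge0 : forall v j, 0 <= a v j) (b_ge0 : forall w j, 0 <= b w j).
Hypothesis a_sum : forall v, \sum_j a v j = 1.
Hypothesis ab_sum : forall j, \sum_v a v j + \sum_w b w j = 1.
Hypothesis a_int : forall v j, a v j != 0 -> h j - y v \is a Num.int.
Hypothesis b_int : forall w i j, b w i != 0 -> b w j != 0 ->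
  h i - h j \is a Num.int.
Hypothesis a_mean : forall v, \sum_j a v j * h j = (1 + k) * y v.
Hypothesis b_mean : forall w, \sum_j b w j * h j = 0.
Hypothesis y_sum : \sum_v y v = 0.

Lemma sum_weights (g : J -> R) :
  \sum_j g j = \sum_v \sum_j a v j * g j + \sum_w \sum_j b w j * g j.
Proof.
rewrite exchange_big [X in _ + X]exchange_big -big_split /=.
by apply: eq_bigr => j _; rewrite -!mulr_suml -mulrDl ab_sum mul1r.
Qed.

Lemma sum_weights_ge (g : J -> R) : (forall j, 0 <= g j) ->
  \sum_v \sum_j a v j * g j <= \sum_j g j.
Proof.
move=> g0; rewrite (sum_weights g) lerDl.
by apply: sumr_ge0 => w _; apply: sumr_ge0 => j _; rewrite mulr_ge0.
Qed.

Lemma sum_periodic_weight (phi : R -> R) (g : J -> R) v :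
  \sum_j a v j * (phi (frac (h j)) * g j) = phi (frac (y v)) * \sum_j a v j * g j.
Proof.
rewrite mulr_sumr; apply: eq_bigr => j _; rewrite mulrCA.
have [->|/a_int/frac_congr -> //] := eqVneq (a v j) 0.
by rewrite !mul0r !mulr0.
Qed.

(** This is the trace of [phi(H) H] computed blockwise. A 1-periodic function
    of [H] is block diagonal and constant on each row of weights, so it can be
    pulled out of the mean values; the complementary block then contributes
    zero. *)
Lemma periodic_trace (phi : R -> R) :
  \sum_j phi (frac (h j)) * h j = (1 + k) * \sum_v phi (frac (y v)) * y v.
Proof.
rewrite sum_weights [X in _ + X]big1 ?addr0 => [|w _].
  rewrite mulr_sumr; apply: eq_bigr => v _.
  by rewrite sum_periodic_weight a_mean; ring.
have [/existsP[i bi]|/existsPn b0] := boolP [exists j, b w j != 0].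
  transitivity (phi (frac (h i)) * \sum_j b w j * h j).
    rewrite mulr_sumr; apply: eq_bigr => j _; rewrite mulrCA.
    have [->|bj] := eqVneq (b w j) 0; first by rewrite !mul0r !mulr0.
    by rewrite (frac_congr (b_int bj bi)).
  by rewrite b_mean mulr0.
by rewrite big1 // => j _; have /eqP -> := negbNE (b0 j); rewrite mul0r.
Qed.

(** Jensen's inequality for a function on the integers with an affine minorant
    touching it at [floor (y v)]. On the support of the weights [h j] and [y v]
    have the same fractional part, so that the integers [floor (h j)] have mean
    [floor (y v) + k * y v]. *)
Lemma weighted_tangent (F : int -> int) (s : int) v :
  (forall m, F (fl (y v)) + s * (m - fl (y v)) <= F m) ->
  (F (fl (y v)))%:~R + s%:~R * (k * y v) <= \sum_j a v j * (F (fl (h j)))%:~R.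
Proof.
move=> tangent.
have -> : (F (fl (y v)))%:~R + s%:~R * (k * y v) =
    \sum_j a v j * ((F (fl (y v)))%:~R + s%:~R * (h j - y v)).
  under eq_bigr do rewrite mulrDr [_ * (_ * _)]mulrCA mulrBr mulrBr.
  rewrite big_split /= -mulr_suml a_sum mul1r; congr (_ + _).
  rewrite sumrB -!mulr_sumr a_mean -mulr_suml a_sum; ring.
apply: ler_sum => j _.
have [->|aj] := eqVneq (a v j) 0; first by rewrite !mul0r.
apply: ler_wpM2l => //.
have e : h j - y v = (fl (h j) - fl (y v))%:~R.
  by have := frac_congr (a_int aj); rewrite /frac intrB; lra.
by rewrite e -intrM -intrD ler_int.
Qed.

Hypothesis k_gt0 : 0 < k.

(** When all [y v] vanish, the integral values among the [h j] add up to zero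
    by [periodic_trace]; as one of them is nonzero, their absolute values
    add up to at least 2. *)
Lemma lattice_gap_fixed : (forall v, y v = 0) ->
  (exists v, exists j, a v j * h j != 0) -> 2 <= \sum_j h j ^+ 2.
Proof.
move=> y0 [v [i avi]].
have hi0 : h i != 0 by apply: contraNneq avi => ->; rewrite mulr0.
have hi : frac (h i) = 0.
  have /a_int : a v i != 0 by apply: contraNneq avi => ->; rewrite mul0r.
  by rewrite y0 => /frac_congr ->; rewrite /frac floor0 subr0.
pose z j : R := (frac (h j) == 0)%:R * h j.
have sz : \sum_j z j = 0.
  have := periodic_trace (fun x => (x == 0)%:R).
  rewrite /z => ->; rewrite [X in _ * X]big1 ?mulr0 // => u _.
  by rewrite y0 mulr0.
have zint j : z j \is a Num.int.
  rewrite /z; case: eqP => [|_]; last by rewrite mul0r.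
  by rewrite mul1r /frac => /subr0_eq ->; rewrite intr_int.
have zi : 1 <= `|z i|.
  apply: norm_intr_ge1 => //; rewrite /z hi eqxx mul1r //.
have s2 : 2 <= \sum_j `|z j|.
  have e : \sum_(j | j != i) z j = - z i.
    by move: sz; rewrite (bigD1 i) //=; lra.
  rewrite (bigD1 i) //=.
  have := ler_norm_sum (index_enum J) z (fun j => j != i).
  by rewrite e normrN; lra.
apply: le_trans s2 _; apply: ler_sum => j _.
have : z j = 0 \/ (z j = h j /\ 1 <= `|h j|).
  have [z0|z0] := eqVneq (z j) 0; first by left.
  right; have zj := norm_intr_ge1 (zint j) z0.
  have e : z j = h j.
    by move: z0; rewrite /z; case: (frac (h j) == 0); rewrite ?mul1r // mul0r eqxx.
  by rewrite -e.
move=> [->|[-> h1]]; first by rewrite normr0 sqr_ge0.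
by rewrite -[leRHS]real_normK ?num_real// expr2 ler_peMr.
Qed.

(** The square splits into a linear part with a 1-periodic coefficient, a
    1-periodic part, and a convex function of the integral part; the first two
    are transported by the weights. *)
Lemma sqr_frac (x : R) : x ^+ 2 = (2 * frac x - 1) * x + frac x * (1 - frac x)
  + (fl x * (fl x + 1))%:~R.
Proof. by rewrite /frac intrM intrD; ring. Qed.

(** The source of the gap: both sums of values of [F] are integers, and Jensen
    makes one strictly larger than the other, hence larger by at least 1. The
    conclusion adds the inequalities with gain 1 and with gain
    [\sum_v e v]. *)
Lemma integral_gain (F : int -> int) (e : V -> R) :
  (forall m, 0 <= F m) ->
  (forall v, 0 <= e v) -> (exists v, 0 < e v) ->
  (forall v, (F (fl (y v)))%:~R + e v <= \sum_j a v j * (F (fl (h j)))%:~R) ->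
  2 * \sum_v (F (fl (y v)))%:~R + \sum_v e v + 1
    <= 2 * \sum_j (F (fl (h j)))%:~R.
Proof.
move=> F0 e0 [u eu] Fe.
have se : 0 < \sum_v e v.
  rewrite (bigD1 u) //= ltr_wpDr // sumr_ge0 //.
have le1 : \sum_v (F (fl (y v)))%:~R + \sum_v e v <= \sum_j (F (fl (h j)))%:~R.
  rewrite -big_split /=.
  apply: le_trans (@sum_weights_ge (fun j => (F (fl (h j)))%:~R) _).
    by apply: ler_sum => v _; exact: Fe.
  by move=> j; rewrite ler0z.
have le2 : \sum_v (F (fl (y v)))%:~R + 1 <= \sum_j (F (fl (h j)))%:~R :> R.
  rewrite -!rmorph_sum /= -[1]/(1%:~R) -intrD ler_int lezD1 -(ltr_int R) !rmorph_sum /=.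
  by apply: lt_le_trans le1; rewrite ltrDl.
lra.
Qed.

(** The convex function [n * (n + 1)] is [2 * F1 + 2 * F2 + F3] with [F1] and
    [F2] the positive parts of [n] and [- 1 - n] and [F3] still convex. As the
    [y v] sum to zero, some are positive and some negative, so [integral_gain]
    applies to both [F1] and [F2] and yields the constant 2. The shift of the
    mean from [n] to [n + k * y v] adds [(1 + 2 * n) * (k * y v)] at [v],
    which exceeds the loss due to the factor [1 + k] by [k * y v ^+ 2]. *)
Lemma lattice_gap_moving : (exists v, y v != 0) ->
  2 + (1 + k) * \sum_v y v ^+ 2 <= \sum_j h j ^+ 2.
Proof.
move=> [u yu].
have ky (v : V) : 0 <= k * y v = (0 <= fl (y v)) by rewrite pmulr_rge0 // floor_ge0.
pose F1 (m : int) : int := Num.max m 0.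
pose F2 (m : int) : int := Num.max (- 1 - m) 0.
pose F3 (m : int) : int := m * (m + 1) - 2 * F1 m - 2 * F2 m.
have F3E m : F3 m = if 0 <= m then m * (m - 1) else (m + 1) * (m + 2).
  by rewrite /F3 /F1 /F2; case: ifP => nm; [rewrite max_l ?max_r | rewrite max_r ?max_l]; lia.
have prod2 (d : int) : 0 <= d * (d - 1) by nia.
pose e1 v := if 0 <= fl (y v) then k * y v else 0.
pose e2 v := if 0 <= fl (y v) then 0 else - (k * y v).
have ys_pos : exists v, 0 < y v.
  apply/existsP; apply: contraNT yu => /existsPn yle.
  have : \sum_v - y v = 0 by rewrite sumrN y_sum oppr0.
  move/eqP; rewrite psumr_eq0 => [/allP/(_ u)|v _]; last by rewrite oppr_ge0 leNgt.
  by rewrite mem_index_enum oppr_eq0; apply.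
have ys_neg : exists v, y v < 0.
  apply/existsP; apply: contraNT yu => /existsPn yge.
  move/eqP: y_sum; rewrite psumr_eq0 => [/allP/(_ u)|v _]; last by rewrite leNgt.
  by rewrite mem_index_enum; apply.
have g1 : 2 * \sum_v (F1 (fl (y v)))%:~R + \sum_v e1 v + 1
    <= 2 * \sum_j (F1 (fl (h j)))%:~R :> R.
  apply: integral_gain => [m|v||v].
  - by rewrite /F1; lia.
  - by rewrite /e1 -ky; case: ifP.
  - have [v yv] := ys_pos; exists v; rewrite /e1 -ky ifT ?mulr_gt0 //.
    by rewrite mulr_ge0 ?ltW.
  - rewrite /e1; case: ifP => nv.
      rewrite -[k * _]mul1r; apply: (@weighted_tangent F1 1) => m.
      by rewrite /F1; lia.
    have := @weighted_tangent F1 0 v; rewrite mulr0z mul0r; apply=> m.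
    by rewrite /F1; lia.
have g2 : 2 * \sum_v (F2 (fl (y v)))%:~R + \sum_v e2 v + 1
    <= 2 * \sum_j (F2 (fl (h j)))%:~R :> R.
  apply: integral_gain => [m|v||v].
  - by rewrite /F2; lia.
  - rewrite /e2 -ky; case: ifP => // /negbT; rewrite -ltNge oppr_ge0; exact: ltW.
  - have [v yv] := ys_neg; exists v; rewrite /e2 -ky ifF ?oppr_gt0 ?pmulr_rlt0 //.
    by apply/negbTE; rewrite -ltNge pmulr_rlt0.
  - rewrite /e2; case: ifP => nv.
      have := @weighted_tangent F2 0 v; rewrite mulr0z mul0r; apply=> m.
      by rewrite /F2; lia.
    have := @weighted_tangent F2 (-1) v; rewrite mulrNz mulN1r; apply=> m.
    by rewrite /F2; lia.
(* the slope of [F3] between n and n + 1 for n >= 0, between n - 1 and n for n < 0 *)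
pose s3 v : int := if 0 <= fl (y v) then 2 * fl (y v) else 2 * (fl (y v) + 1).
have g3 : \sum_v ((F3 (fl (y v)))%:~R + (s3 v)%:~R * (k * y v))
    <= \sum_j (F3 (fl (h j)))%:~R :> R.
  apply: le_trans (@sum_weights_ge (fun j => (F3 (fl (h j)))%:~R) _).
    apply: ler_sum => v _; apply: weighted_tangent => m; rewrite !F3E /s3.
    move: (fl (y v)) => n; have := prod2 (m - n); have := prod2 (n - m).
    by case: ifP => nv; case: ifP => mv; nia.
  move=> j; rewrite ler0z F3E; move: (fl (h j)) => n.
  by have := prod2 n; have := prod2 (n + 2); case: ifP; lia.
pose c (x : R) : R := (fl x * (fl x + 1))%:~R.
have cE x : c x = 2 * (F1 (fl x))%:~R + 2 * (F2 (fl x))%:~R + (F3 (fl x))%:~R.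
  by rewrite /c /F3 !intrD !intrN !intrM; ring.
have gc : 2 + \sum_v (c (y v) + (1 + 2 * (fl (y v))%:~R) * (k * y v))
    <= \sum_j c (h j).
  under [leRHS]eq_bigr do rewrite cE.
  rewrite !big_split /= -!mulr_sumr.
  under [X in 2 + (X + _)]eq_bigr do rewrite cE.
  rewrite !big_split /= -!mulr_sumr.
  rewrite big_split /= in g3.
  have -> : \sum_v (1 + 2 * (fl (y v))%:~R) * (k * y v) =
      \sum_v e1 v + \sum_v e2 v + \sum_v (s3 v)%:~R * (k * y v).
    rewrite -!big_split /=; apply: eq_bigr => v _; rewrite /e1 /e2 /s3.
    by case: ifP => _; rewrite intrM ?intrD; ring.
  lra.
have fr0 (x : R) : 0 <= frac x * (1 - frac x).
  have /andP[f0 f1] := frac_bounds x.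
  by rewrite mulr_ge0 // subr_ge0 ltW.
have fr_le : \sum_v frac (y v) * (1 - frac (y v)) <=
    \sum_j frac (h j) * (1 - frac (h j)).
  apply: le_trans (@sum_weights_ge (fun j => frac (h j) * (1 - frac (h j))) _) => //.
  apply: ler_sum => v _.
  have := sum_periodic_weight (fun x => x * (1 - x)) (fun=> 1) v.
  under eq_bigr do rewrite mulr1; under [X in _ * X]eq_bigr do rewrite mulr1.
  by rewrite a_sum mulr1 => ->.
have -> : \sum_j h j ^+ 2 = \sum_j (2 * frac (h j) - 1) * h j +
    \sum_j frac (h j) * (1 - frac (h j)) + \sum_j c (h j).
  by rewrite -!big_split /=; apply: eq_bigr => j _; rewrite sqr_frac.
rewrite (periodic_trace (fun x => 2 * x - 1)).
apply: le_trans (lerD (lerD (lexx _) fr_le) gc).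
rewrite !mulr_sumr [leRHS]addrCA -!big_split /= lerD2l.
apply: ler_sum => v _.
have e := sqr_frac (y v); rewrite -/(c (y v)) in e.
have e' : y v = (fl (y v))%:~R + frac (y v) by rewrite /frac; ring.
have ke : 0 <= k * (y v) ^+ 2 := mulr_ge0 (ltW k_gt0) (sqr_ge0 _).
have ec : c (y v) = (fl (y v))%:~R * ((fl (y v))%:~R + 1) by rewrite /c intrM intrD.
move: e' ke; rewrite ec.
move: (frac (y v)) ((fl (y v))%:~R) => f N -> ke.
nra.
Qed.

Lemma lattice_gap : (exists v, exists j, a v j * h j != 0) ->
  2 + (1 + k) * \sum_v y v ^+ 2 <= \sum_j h j ^+ 2.
Proof.
move=> ne; have [/forallP y0|] := boolP [forall v, y v == 0].
  rewrite big1 => [|v _]; last by rewrite (eqP (y0 v)) expr0n.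
  by rewrite mulr0 addr0 lattice_gap_fixed // => v; apply/eqP.
by move=> /forallPn; exact: lattice_gap_moving.
Qed.
End Lattice.

(** * The exponential of a real skew matrix *)

Section Exp.
Variable R : realType.
Local Notation C := R[i].
Local Notation toC := (map_mx (real_complex R)).

Lemma cvg_mx (m n : nat) (u : nat -> 'M[R]_(m, n)) (M : 'M[R]_(m, n)) :
  (forall i j, (fun k => u k i j) @ \oo --> M i j) -> u @ \oo --> M.
Proof.
move=> uM; apply/cvgrPdist_le => /= e e0; near=> k.
rewrite /Num.Def.normr/= mx_normrE (bigmax_le _ (ltW e0))//= => i _.
rewrite !mxE/=; move: i; near: k; apply: filter_forall => /= i.
exact: (cvgrPdist_le _ _).1 (uM i.1 i.2) _ e0.
Unshelve. all: by end_near. Qed.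

(** The complex number [exp (i t)]. *)
Definition cis (t : R) : C := (cos t +i* sin t)%C.

Definition imag (t : R) : C := (0 +i* t)%C.

(** The coefficients are those of the cosine and sine series. *)
Lemma imag_exp (t : R) (k : nat) :
  imag t ^+ k = ((~~ odd k)%:R * (-1) ^+ k./2 * t ^+ k +i*
                 ((odd k)%:R * (-1) ^+ k.-1./2 * t ^+ k))%C.
Proof.
elim: k => [|k IH].
  by rewrite !expr0 !mulr1 mulr0n.
rewrite exprS IH /imag; simpc.
rewrite !exprS; case: k {IH} => [|k] //=.
  by rewrite !expr0 !mulr1 mulr0n mulr1n; simpc.
rewrite negbK; congr (_ +i* _)%C; last by rewrite mulrCA.
by rewrite [(-1) ^+ _.+1]exprS mulN1r mulrN mulNr [in LHS]mulrCA.
Qed.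

Lemma cvg_Re_cis (c : C) (t : R) :
  series (fun k => complex.Re (c * (imag t ^+ k * (k`!%:R)^-1%:C%C))) @ \oo
    --> complex.Re (c * cis t).
Proof.
have -> : series (fun k => complex.Re (c * (imag t ^+ k * (k`!%:R)^-1%:C%C))) =
  (fun n => complex.Re c * series (cos_coeff t) n - complex.Im c * series (sin_coeff t) n).
  apply/funext => n; rewrite /series /= !mulr_sumr -sumrB; apply: eq_bigr => k _.
  rewrite imag_exp /cos_coeff /sin_coeff /=; case: c => c1 c2; simpc => /=.
  by rewrite exprnP; ring.
case: c => c1 c2; simpc => /=.
apply: cvgB; apply: cvgMr.
  by rewrite cos.unlock; exact: is_cvg_series_cos_coeff.
by rewrite sin.unlock; exact: is_cvg_series_sin_coeff.
Qed.

Lemma unitarymx_adjK m (P : 'M[C]_m) : P \is unitarymx -> P ^t* *m P = 1%:M.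
Proof. by move=> /unitarymxP/mulmx1C. Qed.

Section UnitaryConjugation.
Variables (m : nat) (P : 'M[C]_m).

(** The rows of the unitary matrix [P] are the adjoints of eigenvectors, with
    eigenvalues [D]. *)
Definition spectral_mx (D : 'I_m -> C) : 'M[C]_m :=
  P ^t* *m diag_mx (\row_k D k) *m P.

Lemma spectral_mxE D i j :
  spectral_mx D i j = \sum_k (P k i)^*%C * P k j * D k.
Proof.
rewrite /spectral_mx -mulmxA mul_diag_mx !mxE; apply: eq_bigr => k _.
by rewrite !mxE mulrAC mulrA.
Qed.

Lemma spectral_mx_adj D : (spectral_mx D) ^t* = spectral_mx (fun k => (D k)^*%C).
Proof.
rewrite /spectral_mx !trmx_mul !map_mxM trmxCK mulmxA; congr (_ *m _ *m _).
by apply/matrixP => i j; rewrite !mxE eq_sym; case: eqP => [->|_];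
  rewrite ?mulr1n ?mulr0n ?rmorph0.
Qed.

Lemma spectral_mxZ c D : c *: spectral_mx D = spectral_mx (fun k => c * D k).
Proof.
have cD : diag_mx (\row_k (c * D k)) = c *: diag_mx (\row_k D k).
  by apply/matrixP => i j; rewrite !mxE mulrnAr.
by rewrite /spectral_mx cD -scalemxAr -scalemxAl.
Qed.

Hypothesis uP : P \is unitarymx.

Lemma spectral_mx1 : spectral_mx (fun=> 1) = 1%:M.
Proof.
have e1 : \row_(k < m) (1 : C) = const_mx 1 by apply/rowP => k; rewrite !mxE.
by rewrite /spectral_mx e1 diag_const_mx mulmx1 unitarymx_adjK.
Qed.

Lemma spectral_mxM D E :
  spectral_mx D *m spectral_mx E = spectral_mx (fun k => D k * E k).
Proof.
have DE : diag_mx (\row_k D k) *m diag_mx (\row_k E k) =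
    diag_mx (\row_k (D k * E k)).
  by rewrite mulmx_diag; congr diag_mx; apply/rowP => k; rewrite !mxE.
rewrite /spectral_mx -DE; have := unitarymxP uP; move: (P ^t*) => Q PQ.
by rewrite !mulmxA -(mulmxA _ P Q) PQ mulmx1.
Qed.

Lemma spectral_mxX D k : spectral_mx D ^+ k = spectral_mx (fun l => D l ^+ k).
Proof.
elim: k => [|k IH]; first by rewrite expr0 -[1]spectral_mx1.
rewrite exprSr IH -[_ * _]/(_ *m _) spectral_mxM.
by congr spectral_mx; apply/funext => l; rewrite exprSr.
Qed.

Lemma mul_spectral_mx D : P *m spectral_mx D = diag_mx (\row_k D k) *m P.
Proof.
rewrite /spectral_mx; have := unitarymxP uP; move: (P ^t*) => Q PQ.
by rewrite !mulmxA PQ mul1mx.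
Qed.

Lemma spectral_mx_mul D : spectral_mx D *m P ^t* = P ^t* *m diag_mx (\row_k D k).
Proof. by rewrite /spectral_mx mulmxtVK. Qed.

Lemma spectral_mxK D : P *m spectral_mx D *m P ^t* = diag_mx (\row_k D k).
Proof. by rewrite mul_spectral_mx mulmxtVK. Qed.

Lemma spectral_mx_inj D E : spectral_mx D = spectral_mx E -> D =1 E.
Proof.
move=> DE k.
have : diag_mx (\row_k D k) = diag_mx (\row_k E k).
  by rewrite -(spectral_mxK D) DE spectral_mxK.
by move/matrixP/(_ k k); rewrite !mxE eqxx !mulr1n.
Qed.

Lemma mxtrace_spectral D : \tr (spectral_mx D) = \sum_k D k.
Proof.
rewrite -[spectral_mx D]mulmx1 -(unitarymx_adjK uP).
rewrite mulmxA mxtrace_mulC mulmxA spectral_mxK mxtrace_diag.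
by apply: eq_bigr => k _; rewrite mxE.
Qed.
End UnitaryConjugation.

Lemma normal_spectral m (X : 'M[C]_m) : X \is normalmx ->
  exists P D, P \is unitarymx /\ X = spectral_mx P D.
Proof.
move=> /orthomx_spectralP XE.
have uS := spectral_unitarymx X.
exists (spectralmx X), (fun k => spectral_diag X 0 k); split; first exact: uS.
have dE : \row_k spectral_diag X 0 k = spectral_diag X.
  by apply/rowP => k; rewrite mxE.
by rewrite /spectral_mx dE -(invmx_unitary uS).
Qed.

Definition skew_spectrum (m : nat) (X : 'M[R]_m) (P : 'M[C]_m) (t : 'I_m -> R) :=
  P \is unitarymx /\ toC X = spectral_mx P (fun k => imag (t k)).

Lemma skew_spectrumP (m : nat) (X : 'M[R]_m) : skew_mx X ->
  exists P t, skew_spectrum X P t.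
Proof.
move=> sX.
have Xt : (toC X) ^t* = - toC X.
  apply/matrixP => i j; rewrite !mxE.
  have -> : X j i = - X i j by move/matrixP: sX => /(_ i j); rewrite !mxE.
  by rewrite raddfN rmorphN; congr (- _); exact: conjc_real.
have [|P [D [uP XE]]] := @normal_spectral _ (toC X).
  by apply/normalmxP; rewrite Xt mulmxN mulNmx.
exists P, (fun k => complex.Im (D k)); split; first exact: uP.
rewrite XE; congr spectral_mx; apply/funext => k.
move: Xt; rewrite XE spectral_mx_adj -scaleN1r spectral_mxZ.
move/(spectral_mx_inj uP)/(_ k); rewrite mulN1r; case: (D k) => x y /(congr1 (@complex.Re R)).
by change (x = - x -> (x +i* y)%C = imag y) => xE; congr (_ +i* _)%C; lra.
Qed.

Section Spectrum.
Variables (m : nat) (X : 'M[R]_m) (P : 'M[C]_m) (t : 'I_m -> R).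
Hypothesis sX : skew_spectrum X P t.

Lemma map_mxX (Y : 'M[R]_m) k : toC (Y ^+ k) = toC Y ^+ k.
Proof.
elim: k => [|k IH]; first by rewrite !expr0 map_mx1.
by rewrite !exprS -IH; exact: map_mxM.
Qed.

(** Convergence is only needed in the topology of real matrices, so the complex
    exponential series is observed through the real part of a multiple of
    each entry: [c = 1] gives the entry of the exponential, [c = - i] shows that
    the spectral formula has no imaginary part. *)
Lemma cvg_Re_spectral (c : C) a b :
  (fun n => complex.Re (c * toC (series (fun k : nat => (k`!%:R)^-1 *: X ^+ k) n) a b))
    @ \oo --> complex.Re (c * spectral_mx P (fun k => cis (t k)) a b).
Proof.
have [uP XE] := sX.
have -> : (fun n => complex.Re (c * toC (series (fun k : nat => (k`!%:R)^-1 *: X ^+ k) n) a b)) =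
  (fun n => \sum_l series (fun k => complex.Re (c * ((P l a)^*%C * P l b) * (imag (t l) ^+ k * (k`!%:R)^-1%:C%C))) n).
  apply/funext => n; rewrite /series /= exchange_big /= map_mx_sum summxE.
  rewrite mulr_sumr raddf_sum; apply: eq_bigr => k _.
  rewrite -raddf_sum /= map_mxZ mxE map_mxX XE spectral_mxX // spectral_mxE.
  rewrite !mulr_sumr; congr complex.Re; apply: eq_bigr => l _.
  by rewrite -!mulrA [RHS]mulrCA; ring.
rewrite spectral_mxE mulr_sumr raddf_sum.
apply: cvg_big => [|l _]; first exact: add_continuous.
by have := @cvg_Re_cis (c * ((P l a)^*%C * P l b)) (t l); rewrite -[c * _ * cis _]mulrA.
Qed.

Lemma Re_mulNi (z : C) : complex.Re (- 'i%C * z) = complex.Im z.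
Proof. by case: z => x y /=; ring. Qed.

Lemma exp_mx_spectrum : toC (exp_mx X) = spectral_mx P (fun k => cis (t k)).
Proof.
have expE : exp_mx X = \matrix_(a, b) complex.Re (spectral_mx P (fun k => cis (t k)) a b).
  apply: (cvg_lim (@norm_hausdorff _ _)); apply: cvg_mx => a b; rewrite mxE.
  have := @cvg_Re_spectral 1 a b; rewrite mul1r.
  by under eq_cvg do rewrite mul1r mxE.
apply/matrixP => a b; rewrite mxE expE mxE.
suff : complex.Im (spectral_mx P (fun k => cis (t k)) a b) = 0.
  by move: (spectral_mx P (fun k => cis (t k)) a b) => [x y] /= ->.
have h := @cvg_Re_spectral (- 'i%C) a b.
have e0 : (fun n => complex.Re (- 'i%C * toC (series (fun k : nat => (k`!%:R)^-1 *: X ^+ k) n) a b))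
    = (fun=> 0).
  by apply/funext => n; rewrite Re_mulNi mxE.
rewrite e0 in h.
rewrite -Re_mulNi.
by apply: (cvg_unique _ h (cvg_cst _)); exact: norm_hausdorff.
Qed.
End Spectrum.

Lemma skew_spectrumZ m (X : 'M[R]_m) P (t : 'I_m -> R) s :
  skew_spectrum X P t -> skew_spectrum (s *: X) P (fun k => s * t k).
Proof.
case=> uP XE; split; first exact: uP.
rewrite map_mxZ XE spectral_mxZ; congr spectral_mx; apply/funext => k.
by rewrite /imag /real_complex_def; simpc.
Qed.

Lemma skewZ m (X : 'M[R]_m) s : skew_mx X -> skew_mx (s *: X).
Proof. by rewrite /skew_mx linearZ /= => ->; rewrite scalerN. Qed.

Lemma toC_inj m n : injective (map_mx (real_complex R) : 'M[R]_(m, n) -> _).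
Proof. exact: map_mx_inj. Qed.

Lemma cis0 : cis (0 : R) = 1.
Proof. by rewrite /cis cos0 sin0. Qed.

Lemma cisJ (t : R) : (cis t)^*%C * cis t = 1.
Proof.
rewrite /cis; simpc; rewrite -!expr2 cos2Dsin2.
by congr (_ +i* _)%C; ring.
Qed.

Lemma cisD (s t : R) : cis (s + t) = cis s * cis t.
Proof.
rewrite /cis cosD sinD; simpc; congr (_ +i* _)%C; ring.
Qed.

Lemma exp_mx0 m : exp_mx (0 : 'M[R]_m) = 1%:M.
Proof.
have s0 : skew_mx (0 : 'M[R]_m) by rewrite /skew_mx linear0 oppr0.
have [P [t sp]] := skew_spectrumP s0.
have := skew_spectrumZ 0 sp; rewrite scaler0 => /exp_mx_spectrum e.
apply: toC_inj; rewrite e map_mx1 -(spectral_mx1 sp.1); congr spectral_mx.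
by apply/funext => k; rewrite mul0r cis0.
Qed.

Lemma exp_mx_comm m (X : 'M[R]_m) s : skew_mx X ->
  X *m exp_mx (s *: X) = exp_mx (s *: X) *m X.
Proof.
move=> /skew_spectrumP[P [t sp]]; have [uP XE] := sp; apply: toC_inj.
have eE := exp_mx_spectrum (skew_spectrumZ s sp).
rewrite !map_mxM eE XE !(spectral_mxM uP).
by congr spectral_mx; apply/funext => k; rewrite mulrC.
Qed.

Lemma exp_mx_orthogonal m (X : 'M[R]_m) : skew_mx X -> orthogonal_mx (exp_mx X).
Proof.
move=> /skew_spectrumP[P [t sp]]; apply: toC_inj.
have e := exp_mx_spectrum sp.
have -> : toC ((exp_mx X)^T *m exp_mx X) = (toC (exp_mx X)) ^t* *m toC (exp_mx X).
  rewrite map_mxM; congr (_ *m _); apply/matrixP => i j; rewrite !mxE.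
  exact/esym/conjc_real.
rewrite e spectral_mx_adj (spectral_mxM sp.1).
rewrite map_mx1 -(spectral_mx1 sp.1); congr spectral_mx.
by apply/funext => k; rewrite cisJ.
Qed.

Lemma is_derive_mx m n (M : R -> 'M[R]_(m, n)) (D : 'M[R]_(m, n)) (t : R) :
  (forall i j, is_derive t (1 : R) (fun s => M s i j) (D i j)) -> is_derive t (1 : R) M D.
Proof.
move=> MD.
have dM : derivable M t 1 by apply/derivable_mxP => i j; case: (MD i j).
apply: DeriveDef => //; rewrite derive_mx //.
by apply/matrixP => i j; rewrite mxE; case: (MD i j).
Qed.

Lemma is_derive_mx_entry m n (M : R -> 'M[R]_(m, n)) (D : 'M[R]_(m, n)) (t : R) i j :
  is_derive t (1 : R) M D -> is_derive t (1 : R) (fun s => M s i j) (D i j).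
Proof.
case=> dM DM; apply: DeriveDef; first by move/derivable_mxP: dM.
by move: DM; rewrite derive_mx // => /matrixP/(_ i j); rewrite mxE.
Qed.

Lemma is_derive_mulmx m n p (M : R -> 'M[R]_(m, n)) (N : R -> 'M[R]_(n, p)) D E (t : R) :
  is_derive t (1 : R) M D -> is_derive t (1 : R) N E ->
  is_derive t (1 : R) (fun s => M s *m N s) (D *m N t + M t *m E).
Proof.
move=> MD NE; apply: is_derive_mx => i j.
have -> : (fun s => (M s *m N s) i j) = \sum_k (fun s => M s i k * N s k j).
  by apply/funext => s; rewrite mxE fct_sumE.
rewrite !mxE -big_split /=; apply: is_derive_sum => k.
have dM := is_derive_mx_entry i k MD; have dN := is_derive_mx_entry k j NE.
apply: is_derive_eq; rewrite /GRing.scale /=; ring.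
Qed.

Lemma is_derive_Re_cis (c : C) (u t : R) :
  is_derive t (1 : R) (fun s => complex.Re (c * cis (s * u)))
    (complex.Re (c * (imag u * cis (t * u)))).
Proof.
case: c => x y.
have -> : (fun s => complex.Re ((x +i* y)%C * cis (s * u))) =
    (fun s => x * cos (s * u) - y * sin (s * u)).
  by apply/funext => s; rewrite /cis; simpc.
have h : is_derive t (1 : R) ( *%R^~ u) u.
  by apply: is_derive_eq; rewrite /GRing.scale /= mulr1 mulr0 add0r.
have hc : is_derive t (1 : R) (fun s => cos (s * u)) (- sin (t * u) * u).
  exact: (@is_derive1_comp _ cos ( *%R^~ u) t _ _ (is_derive_cos (t * u)) h).
have hs : is_derive t (1 : R) (fun s => sin (s * u)) (cos (t * u) * u).
  exact: (@is_derive1_comp _ sin ( *%R^~ u) t _ _ (is_derive_sin (t * u)) h).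
have -> : complex.Re ((x +i* y)%C * (imag u * cis (t * u))) =
    x *: (- sin (t * u) * u) - y *: (cos (t * u) * u).
  by rewrite /cis /imag; simpc => /=; rewrite /GRing.scale /=; ring.
exact: (is_deriveB (is_deriveZ x hc) (is_deriveZ y hs)).
Qed.

Lemma is_derive_exp m (X : 'M[R]_m) (t : R) : skew_mx X ->
  is_derive t (1 : R) (fun s => exp_mx (s *: X)) (X *m exp_mx (t *: X)).
Proof.
move=> /skew_spectrumP[P [u sp]]; apply: is_derive_mx => i j.
have expE s : exp_mx (s *: X) i j =
    \sum_k complex.Re ((P k i)^*%C * P k j * cis (s * u k)).
  rewrite -raddf_sum -spectral_mxE -(exp_mx_spectrum (skew_spectrumZ s sp)).
  by rewrite mxE.
have -> : (fun s => exp_mx (s *: X) i j) =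
    \sum_k (fun s => complex.Re ((P k i)^*%C * P k j * cis (s * u k))).
  by apply/funext => s; rewrite fct_sumE expE.
have -> : (X *m exp_mx (t *: X)) i j =
    \sum_k complex.Re ((P k i)^*%C * P k j * (imag (u k) * cis (t * u k))).
  rewrite -raddf_sum -spectral_mxE -spectral_mxM ?sp.1 // -sp.2.
  by rewrite -(exp_mx_spectrum (skew_spectrumZ t sp)) -map_mxM [in RHS]mxE.
by apply: is_derive_sum => k; exact: is_derive_Re_cis.
Qed.
End Exp.

(** * Velocity and length of geodesics *)

Section Geodesics.
Variables (R : realType) (p q : nat) (beta : R).
Implicit Types (A : 'M[R]_p) (B : 'M[R]_(q, p)).

Definition generator A B : 'M[R]_(p + q) :=
  block_mx ((2 * beta) *: A) (- B^T) B 0.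

(** The squared speed, which equals the squared length when the time is 1. *)
Definition energy A B : R :=
  beta * \tr (A^T *m A) + \tr (B^T *m B).

Lemma skew_generator A B : skew_mx A -> skew_mx (generator A B).
Proof.
move=> sA; rewrite /skew_mx /generator tr_block_mx opp_block_mx trmx0 oppr0 opprK.
have -> : (- B^T)^T = - B by apply/matrixP => i j; rewrite !mxE.
by rewrite linearZ /= (sA : _ = _) scalerN.
Qed.

Lemma geodesic_at_InpE A B t : geodesic_at_Inp beta A B t =
  exp_mx (t *: generator A B) *m Inp R p q *m exp_mx (t *: ((1 - 2 * beta) *: A)).
Proof. by rewrite /geodesic_at_Inp scalerA. Qed.

Lemma geodesic_at_Inp0 A B : geodesic_at_Inp beta A B 0 = Inp R p q.
Proof. by rewrite geodesic_at_InpE !scale0r !exp_mx0 mul1mx mulmx1. Qed.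

Lemma orthogonal_mxM m (P Q : 'M[R]_m) :
  orthogonal_mx P -> orthogonal_mx Q -> orthogonal_mx (P *m Q).
Proof.
move=> oP oQ; rewrite /orthogonal_mx trmx_mul -mulmxA (mulmxA P^T).
by rewrite (oP : _ = _) mul1mx.
Qed.

Lemma tr_gram_orthogonal m n (B : 'M[R]_(m, n)) (E : 'M[R]_n) :
  orthogonal_mx E -> \tr ((B *m E)^T *m (B *m E)) = \tr (B^T *m B).
Proof.
by move=> /mulmx1C oE; rewrite mxtrace_mulC trmx_mul !mulmxA -(mulmxA B) oE mulmx1 mxtrace_mulC.
Qed.

Lemma tr_gramZ m n (c : R) (D : 'M[R]_(m, n)) :
  \tr ((c *: D)^T *m (c *: D)) = c ^+ 2 * \tr (D^T *m D).
Proof.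
have -> : (c *: D)^T = c *: D^T by apply/matrixP => i j; rewrite !mxE.
by rewrite -scalemxAl -scalemxAr scalerA mxtraceZ expr2.
Qed.

Section Velocity.
Variables (Q : 'M[R]_(p + q)) (A : 'M[R]_p) (B : 'M[R]_(q, p)).
Hypotheses (oQ : orthogonal_mx Q) (sA : skew_mx A).

(** The skew matrix [X] commutes with its exponential, so the derivative is the
    initial velocity [X I - I (2 beta - 1) A], whose blocks are [A] and [B],
    placed between the two exponentials. *)
Lemma is_derive_geodesic t :
  is_derive t (1 : R) (fun s => Q *m geodesic_at_Inp beta A B s)
   (Q *m exp_mx (t *: generator A B) *m col_mx A B
      *m exp_mx (t *: ((1 - 2 * beta) *: A))).
Proof.
set X := generator A B; set Y := (1 - 2 * beta) *: A.
have -> : (fun s => Q *m geodesic_at_Inp beta A B s) =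
    (fun s => (Q *m exp_mx (s *: X)) *m (Inp R p q *m exp_mx (s *: Y))).
  by apply/funext => s; rewrite geodesic_at_InpE !mulmxA.
have sX : skew_mx X by exact: skew_generator.
have sY : skew_mx Y by exact: skewZ.
have dc m n (M : 'M[R]_(m, n)) : is_derive t (1 : R) (fun=> M) 0.
  exact: is_derive_cst.
have dX := is_derive_mulmx (dc _ _ Q) (is_derive_exp t sX).
have dY := is_derive_mulmx (dc _ _ (Inp R p q)) (is_derive_exp t sY).
have := is_derive_mulmx dX dY; rewrite !mul0mx !add0r exp_mx_comm //.
congr (is_derive _ _ _ _); rewrite !mulmxA -mulmxDl; congr (_ *m _).
rewrite -!mulmxA -!mulmxDr; congr (_ *m (_ *m _)).
rewrite /Inp /X /generator mul_block_col mul_col_mx !mulmx1 !mul1mx !mulmx0 mul0mx.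
by rewrite !addr0 add_col_mx addr0 /Y -scalerDl addrC subrK scale1r.
Qed.

(** The speed is constant since both exponentials are orthogonal: the moving
    frame [S] carries a completion of the base point along the geodesic, and
    the components of the velocity are the conjugate of [A] and a rotation
    of [B]. *)
Lemma speed_geodesic t :
  speed beta (fun s => Q *m geodesic_at_Inp beta A B s) t =
  Num.sqrt (energy A B).
Proof.
have [_ dg] := is_derive_geodesic t.
rewrite /speed derive1E dg geodesic_at_InpE.
set E1 := exp_mx (t *: generator A B); set E2 := exp_mx (t *: _).
have o1 : orthogonal_mx E1 by apply/exp_mx_orthogonal/skewZ/skew_generator.
have o2 : orthogonal_mx E2 by apply/exp_mx_orthogonal/skewZ/skewZ.
have oS : orthogonal_mx (Q *m E1) by exact: orthogonal_mxM.
rewrite !mulmxA; move: (Q *m E1) oS => S oS.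
have bE : S *m Inp R p q *m E2 = S *m col_mx E2 0.
  by rewrite -mulmxA /Inp mul_col_mx mul1mx mul0mx.
have comp : completes (S *m Inp R p q *m E2) (S *m col_mx 0 1%:M).
  rewrite /completes bE -mul_mx_row; apply: orthogonal_mxM => //.
  rewrite /orthogonal_mx -block_mxEh tr_block_mx mulmx_block.
  rewrite !trmx0 !mulmx0 !mul0mx !addr0 !add0r trmx1 mulmx1 (o2 : _ = _).
  by rewrite -scalar_mx_block.
rewrite (beta_metricE _ _ _ comp); congr Num.sqrt; rewrite /energy.
have gA : (S *m Inp R p q *m E2)^T *m (S *m col_mx A B *m E2) = E2^T *m (A *m E2).
  rewrite bE trmx_mul !mulmxA -(mulmxA _ S^T) (oS : _ = _) mulmx1.
  by rewrite tr_col_mx mul_row_col trmx0 mul0mx addr0.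
have gB : (S *m col_mx 0 1%:M)^T *m (S *m col_mx A B *m E2) = B *m E2.
  rewrite trmx_mul !mulmxA -(mulmxA _ S^T) (oS : _ = _) mulmx1.
  by rewrite tr_col_mx mul_row_col trmx0 trmx1 mul0mx add0r mul1mx.
rewrite gA gB (tr_gram_orthogonal B o2); congr (_ * _ + _).
rewrite trmx_mul trmxK !mulmxA -(mulmxA _ E2) (mulmx1C o2) mulmx1.
by rewrite -mulmxA tr_gram_orthogonal.
Qed.

Lemma length_geodesic T : 0 < T ->
  riemannian_length beta (fun s => Q *m geodesic_at_Inp beta A B s) T =
  T * Num.sqrt (energy A B).
Proof.
move=> T0; rewrite /riemannian_length.
under eq_Rintegral do rewrite speed_geodesic.
rewrite Rintegral_cst //= lebesgue_measure_itv /= lte_fin T0 oppr0 /= addr0 mulrC //.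
Qed.

Lemma nonconstant_geodesic T : 0 < T -> 0 < energy A B ->
  exists2 t : R, t \in `[0, T] &
    Q *m geodesic_at_Inp beta A B t != Q *m geodesic_at_Inp beta A B 0.
Proof.
move=> T0 E0; apply: contrapT => noex.
have cst t : t \in `[0, T] ->
    Q *m geodesic_at_Inp beta A B t = Q *m geodesic_at_Inp beta A B 0.
  by move=> tT; apply: contrapT => /eqP ne; apply: noex; exists t.
move: E0; rewrite -sqrtr_gt0 -(speed_geodesic (T / 2)) /speed derive1E.
have -> : 'D_1 (fun s => Q *m geodesic_at_Inp beta A B s) (T / 2) = 0.
  rewrite -[RHS](derive_cst (Q *m geodesic_at_Inp beta A B 0) (T / 2) (1 : R)).
  apply: near_eq_derive; near=> s; apply: cst; rewrite in_itv /=; apply/andP; split.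
    by apply/ltW; near: s; apply: lt_nbhsr; rewrite divr_gt0.
  by apply/ltW; near: s; apply: lt_nbhsl; lra.
by rewrite /beta_metric !mulmx0 !linear0 mulr0 addr0 sqrtr0 ltxx.
Unshelve. all: by end_near. Qed.
End Velocity.
End Geodesics.

(** * Squared moduli of unitary matrices and block-diagonal unitary matrices *)

Section Weights.
Variable R : realType.
Local Notation C := R[i].
Local Notation toC := (map_mx (real_complex R)).

Lemma cos_eq1 (t : R) : cos t = 1 -> t / (2 * pi) \is a Num.int.
Proof.
move=> ct; have pi0 := pi_gt0 R.
have s0 : sin (t / 2) = 0.
  have := cos_mulr2n (t / 2); have -> : t / 2 *+ 2 = t by rewrite mulr2n; lra.
  rewrite ct cos2sin2 mulr2n => e; apply/eqP; rewrite -sqrf_eq0; apply/eqP; lra.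
set u := t / 2 in s0 *; set z := Num.floor (u / pi).
have /andP[zl zr] := floor_itv (u / pi); rewrite -/z in zl zr.
have sinz (x : R) (k : int) : sin x = 0 -> sin (x - k%:~R * pi) = 0.
  case: k => k sx0.
    have := alternatingn (@sinDpi R) k (x - k%:~R * pi).
    rewrite -mulr_natl subrK sx0 => /esym/eqP; rewrite mulf_eq0 => /orP[|/eqP->//].
    by rewrite signr_eq0.
  rewrite NegzE mulrNz mulNr opprK.
  have := alternatingn (@sinDpi R) k.+1 x.
  by rewrite -mulr_natl sx0 mulr0.
have s1 := sinz u z s0.
have [u0|u0] := eqVneq (u - z%:~R * pi) 0.
  have -> : t / (2 * pi) = z%:~R; last by rewrite intr_int.
  have -> : t = 2 * z%:~R * pi by rewrite /u in u0; lra.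
  by field; lra.
have : 0 < sin (u - z%:~R * pi).
  apply: sin_gt0_pi; rewrite lt_def u0 /=; apply/andP; split.
    by rewrite subr_ge0 -ler_pdivlMr.
  by move: zr; rewrite intrD ltr_pdivrMr //; lra.
by rewrite s1 ltxx.
Qed.

Lemma cis_inj (s t : R) : cis s = cis t -> s / (2 * pi) - t / (2 * pi) \is a Num.int.
Proof.
move=> [cst sst]; rewrite -mulrBl; apply: cos_eq1.
by rewrite cosB cst sst -!expr2 cos2Dsin2.
Qed.

Definition sqn (z : C) : R := complex.Re z ^+ 2 + complex.Im z ^+ 2.

Lemma sqnE (z : C) : (sqn z)%:C%C = z * z^*%C.
Proof. by case: z => x y; rewrite /sqn; simpc; congr (_ +i* _)%C; ring. Qed.

Lemma sqn_ge0 z : 0 <= sqn z.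
Proof. by rewrite addr_ge0 ?sqr_ge0. Qed.

Lemma sqn_eq0 z : (sqn z == 0) = (z == 0).
Proof.
by rewrite paddr_eq0 ?sqr_ge0 // !sqrf_eq0 eq_complex.
Qed.

(** When [T] is unitary the sum on the right is a mean of the [th j]. *)
Lemma sum_sqn_row m n (T : 'M[C]_(m, n)) i (th : 'I_n -> R) :
  (T *m diag_mx (\row_j imag (th j)) *m T ^t*) i i =
  imag (\sum_j sqn (T i j) * th j).
Proof.
rewrite -mulmxA mul_diag_mx mxE.
transitivity (\sum_j 'i%C * (sqn (T i j) * th j)%:C%C).
  apply: eq_bigr => j _; rewrite !mxE rmorphM /= sqnE /imag.
  have -> : (0 +i* th j)%C = 'i%C * (th j)%:C%C by simpc.
  change (T i j * ('i%C * (th j)%:C%C * (T i j)^*%C) = 'i%C * (T i j * (T i j)^*%C * (th j)%:C%C)).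
  ring.
by rewrite -mulr_sumr -rmorph_sum /imag; simpc.
Qed.

Lemma sum_sqn_unitary m n (T : 'M[C]_(m, n)) i : T \is unitarymx ->
  \sum_j sqn (T i j) = 1.
Proof.
move=> /unitarymxP/matrixP/(_ i i); rewrite !mxE eqxx => e.
apply: (@complexI R); rewrite rmorph_sum rmorph1 -[RHS]e; apply: eq_bigr => j _.
by rewrite !mxE; exact: sqnE.
Qed.

Lemma tr_gram_skew m (X : 'M[R]_m) P (t : 'I_m -> R) : skew_mx X ->
  skew_spectrum X P t -> \tr (X^T *m X) = \sum_k t k ^+ 2.
Proof.
move=> sX [uP XE]; apply: (@complexI R).
rewrite (sX : _ = _) mulNmx -[LHS]/(real_complex R _) -trace_map_mx map_mxN map_mxM.
rewrite XE spectral_mxM // linearN /= mxtrace_spectral // -sumrN rmorph_sum.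
by apply: eq_bigr => k _; rewrite /imag; simpc; rewrite expr2.
Qed.

Lemma sum_skew_spectrum m (X : 'M[R]_m) P (t : 'I_m -> R) : skew_mx X ->
  skew_spectrum X P t -> \sum_k t k = 0.
Proof.
move=> sX [uP XE].
have tr0 : \tr X = 0 by have := mxtrace_tr X; rewrite (sX : _ = _) linearN /=; lra.
have : \tr (toC X) = 0 by rewrite trace_map_mx tr0 rmorph0.
rewrite XE mxtrace_spectral //.
have -> : \sum_k imag (t k) = imag (\sum_k t k).
  transitivity (\sum_k 'i%C * (t k)%:C%C); first by apply: eq_bigr => k _; rewrite /imag; simpc.
  by rewrite -mulr_sumr -rmorph_sum /imag; simpc.
by case.
Qed.

(** The columns of a unitary matrix are orthonormal: once the first ones fill
    the upper left corner with a unitary matrix, the others have no upper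
    part. *)
Lemma unitary_block p q (E : 'M[C]_(p + q)) (E1 : 'M[C]_p) :
  E \is unitarymx -> E1 \is unitarymx ->
  E *m col_mx 1%:M 0 = col_mx E1 0 ->
  exists2 Q, Q \is unitarymx & E = block_mx E1 0 0 Q.
Proof.
move=> uE uE1; rewrite -[E]submxK mul_block_col !mulmx1 !mulmx0 !addr0.
move=> /eq_col_mx[ulE dlE]; rewrite ulE dlE.
have := unitarymx_adjK uE; rewrite -{1 2}[E]submxK ulE dlE.
rewrite tr_block_mx map_block_mx mulmx_block scalar_mx_block.
rewrite trmx0 !map_mx0 !mul0mx !mulmx0 !addr0 ?add0r.
move=> /eq_block_mx[_ urE _ drE].
have ur0 : ursubmx E = 0.
  by rewrite -[LHS]mul1mx -(unitarymxP uE1) -mulmxA urE mulmx0.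
move: drE; rewrite ur0 mulmx0 add0r => drE.
exists (drsubmx E) => //; rewrite -trmxC_unitary; apply/unitarymxP.
by rewrite trmxCK.
Qed.

End Weights.

(** * Closed geodesics are not short *)

Section LowerBound.
Variables (R : realType) (p q : nat) (beta : R) (A : 'M[R]_p) (B : 'M[R]_(q, p)).
Local Notation C := R[i].
Local Notation toC := (map_mx (real_complex R)).

(** Closing up at time 1 means that the exponential of [X] is block diagonal
    with first block [exp (Y)]. The unitary matrix whose rows are those of
    [Tu] and [Td] passes from an eigenbasis of [X] to eigenbases of [Y] and of
    the second block [Q]; the frequencies of [X] that meet one eigenvector of
    [Q] agree modulo [2 pi]. Finally [2 * energy] is the squared norm of [X] minus
    [1 + k] times that of [Y], where [k = (2 * beta - 1)^-1] is positive as soon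
    as [beta > 1/2]. *)
Lemma closed_geodesic_energy : 1 / 2 < beta -> skew_mx A ->
  geodesic_at_Inp beta A B 1 = Inp R p q -> ~ (A = 0 /\ B = 0) ->
  (2 * pi) ^+ 2 <= energy beta A B.
Proof.
move=> hbeta sA closed AB0; have pi0 := pi_gt0 R.
set X := generator beta A B; set Y := (2 * beta - 1) *: A.
have sX : skew_mx X by exact: skew_generator.
have sY : skew_mx Y by exact: skewZ.
have [M [th spX]] := skew_spectrumP sX; have [uM XE] := spX.
have [P1 [et spY]] := skew_spectrumP sY; have [uP1 YE] := spY.
set Ec := toC (exp_mx X).
have EcE : Ec = spectral_mx M (fun k => cis (th k)) := exp_mx_spectrum spX.
set E1 := spectral_mx P1 (fun k => cis (et k)).
have unitary_cis m (P : 'M[C]_m) (t : 'I_m -> R) : P \is unitarymx ->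
    spectral_mx P (fun k => cis (t k)) \is unitarymx.
  move=> uP; apply/unitarymxP; rewrite spectral_mx_adj spectral_mxM //.
  rewrite -(spectral_mx1 uP); congr spectral_mx; apply/funext => k.
  by rewrite mulrC cisJ.
have closedC : Ec *m col_mx 1%:M 0 = col_mx E1 0.
  have IE : toC (Inp R p q) = col_mx 1%:M 0.
    by rewrite /Inp map_col_mx map_mx1 map_mx0.
  have YN : 1 *: ((1 - 2 * beta) *: A) = (-1) *: Y.
    by rewrite scale1r /Y scalerA; congr (_ *: _); ring.
  have EN := exp_mx_spectrum (skew_spectrumZ (-1) spY).
  have := congr1 (fun M => toC M *m E1) closed.
  rewrite geodesic_at_InpE YN scale1r !map_mxM IE.
  rewrite EN -(mulmxA _ _ E1) (spectral_mxM uP1).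
  have -> : (fun k => cis ((-1) * et k) * cis (et k)) = (fun=> 1).
    by apply/funext => k; rewrite -cisD mulN1r addNr cis0.
  by rewrite spectral_mx1 // mulmx1 mul_col_mx mul1mx mul0mx.
have uEc : Ec \is unitarymx by rewrite EcE; exact: unitary_cis.
have [Q uQ EcQ] := unitary_block uEc (unitary_cis _ _ _ uP1) closedC.
have [|P2 [mu [uP2 QE]]] := @normal_spectral _ _ Q.
  by apply/normalmxP; rewrite (unitarymxP uQ) unitarymx_adjK.
pose Tu := row_mx P1 (0 : 'M[C]_(p, q)) *m M ^t*.
pose Td := row_mx (0 : 'M[C]_(q, p)) P2 *m M ^t*.
have uT : col_mx Tu Td \is unitarymx.
  rewrite -(mul_col_mx (row_mx P1 0) (row_mx 0 P2) (M ^t*)).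
  refine (mul_unitarymx _ _); last by rewrite trmxC_unitary; exact: uM.
  change (block_mx P1 0 0 P2 \is unitarymx).
  apply/unitarymxP; rewrite tr_block_mx map_block_mx mulmx_block.
  rewrite !trmx0 !map_mx0 !mulmx0 !mul0mx !addr0 !add0r.
  by rewrite (unitarymxP uP1) (unitarymxP uP2) -scalar_mx_block.
have uTu : Tu \is unitarymx.
  move/unitarymxP: uT; rewrite tr_col_mx map_row_mx mul_col_row scalar_mx_block.
  by move=> /eq_block_mx[h _ _ _]; apply/unitarymxP.
have Tu_cis v j : Tu v j * cis (th j) = cis (et v) * Tu v j.
  have : Tu *m diag_mx (\row_j cis (th j)) = diag_mx (\row_j cis (et j)) *m Tu.
    rewrite /Tu -mulmxA -(spectral_mx_mul uM) -EcE EcQ mulmxA mul_row_block.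
    by rewrite !mul0mx !mulmx0 !addr0 mul_spectral_mx // mulmxA mul_mx_row mulmx0.
  by move=> /matrixP/(_ v j); rewrite mul_mx_diag mul_diag_mx !mxE.
have Td_cis w j : Td w j * cis (th j) = mu w * Td w j.
  have : Td *m diag_mx (\row_j cis (th j)) = diag_mx (\row_j mu j) *m Td.
    rewrite /Td -mulmxA -(spectral_mx_mul uM) -EcE EcQ mulmxA mul_row_block.
    by rewrite QE !mul0mx !mulmx0 !add0r mul_spectral_mx // mulmxA mul_mx_row mulmx0.
  by move=> /matrixP/(_ w j); rewrite mul_mx_diag mul_diag_mx !mxE.
have XC : toC X = block_mx (toC ((2 * beta) *: A)) (toC (- B^T)) (toC B) 0.
  by rewrite /X /generator map_block_mx map_mx0.
have conj_generator n (K : 'M[C]_(n, p + q)) :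
    K *m M ^t* *m diag_mx (\row_j imag (th j)) *m (K *m M ^t*) ^t* = K *m toC X *m K ^t*.
  by rewrite trmx_mul map_mxM trmxCK !mulmxA -(mulmxA K) -(mulmxA K) XE.
have imag_inj : injective (@imag R) by move=> x y [].
have YXE : toC ((2 * beta) *: A) = (1 + (2 * beta - 1)^-1)%:C%C *: toC Y.
  rewrite /Y -map_mxZ scalerA; congr (toC (_ *: A)).
  by field; lra.
have Tu_mean v : \sum_j sqn (Tu v j) * th j = (1 + (2 * beta - 1)^-1) * et v.
  have := sum_sqn_row Tu v th; rewrite conj_generator XC mul_row_block.
  rewrite !mul0mx !addr0 tr_row_mx map_col_mx mul_row_col trmx0 map_mx0 mulmx0 addr0.
  rewrite YXE -scalemxAr -scalemxAl YE mul_spectral_mx // mulmxtVK // !mxE eqxx mulr1n.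
  by move=> e; apply: imag_inj; rewrite -e /imag; simpc.
have Td_mean w : \sum_j sqn (Td w j) * th j = 0.
  have := sum_sqn_row Td w th; rewrite conj_generator XC mul_row_block.
  rewrite !mul0mx !add0r tr_row_mx map_col_mx mul_row_col trmx0 map_mx0 !mulmx0.
  by rewrite add0r mul0mx mxE => e; apply: imag_inj; rewrite -e.
pose h j := th j / (2 * pi); pose y v := et v / (2 * pi).
have gap : 2 + (1 + (2 * beta - 1)^-1) * \sum_v y v ^+ 2 <= \sum_j h j ^+ 2.
  apply: (@lattice_gap _ _ _ _ (fun v j => sqn (Tu v j)) (fun w j => sqn (Td w j))).
  - by move=> v j; exact: sqn_ge0.
  - by move=> w j; exact: sqn_ge0.
  - by move=> v; have := sum_sqn_unitary v uTu.
  - move=> j.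
    have : (col_mx Tu Td)^T \is unitarymx by rewrite trmx_unitary.
    move=> /(sum_sqn_unitary j); rewrite big_split_ord /= => <-.
    by congr (_ + _); apply: eq_bigr => i _; rewrite [in RHS]mxE ?col_mxEu ?col_mxEd.
  - move=> v j; rewrite sqn_eq0 => T0; apply: cis_inj; apply: (mulfI T0).
    by rewrite Tu_cis mulrC.
  - move=> w i j; rewrite !sqn_eq0 => Ti Tj; apply: cis_inj.
    have ei : cis (th i) = mu w by apply: (mulfI Ti); rewrite Td_cis mulrC.
    by rewrite ei; apply: (mulfI Tj); rewrite Td_cis mulrC.
  - move=> v; rewrite /h /y; under eq_bigr do rewrite mulrA.
    by rewrite -mulr_suml Tu_mean mulrA.
  - move=> w; rewrite /h; under eq_bigr do rewrite mulrA.
    by rewrite -mulr_suml Td_mean mul0r.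
  - by rewrite /y -mulr_suml (sum_skew_spectrum sY spY) mul0r.
  - by rewrite invr_gt0; lra.
  apply: contrapT => noex; apply: AB0.
  have TX0 : Tu *m diag_mx (\row_j imag (th j)) = 0.
    apply/matrixP => v j; rewrite mul_mx_diag [LHS]mxE [X in _ * X]mxE [RHS]mxE.
    have [->|T0] := eqVneq (Tu v j) 0; first by rewrite mul0r.
    have [->|t0] := eqVneq (th j) 0; first by rewrite mulr0.
    case: noex; exists v, j; rewrite mulf_neq0 ?sqn_eq0 // /h mulf_neq0 //.
    by rewrite invr_neq0; lra.
  have : P1 *m row_mx (toC ((2 * beta) *: A)) (toC (- B^T)) = 0.
    move: TX0; rewrite /Tu -mulmxA -(spectral_mx_mul uM) -XE XC mulmxA mul_row_block.
    rewrite !mul0mx !addr0 -mul_mx_row => /(congr1 (mulmx^~ M)).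
    by rewrite mul0mx -mulmxA (unitarymx_adjK uM) mulmx1.
  move/(congr1 (mulmx (P1 ^t*))); rewrite mulmxA unitarymx_adjK // mul1mx mulmx0.
  rewrite -map_row_mx -[RHS](map_mx0 (real_complex R)) => /toC_inj.
  rewrite -row_mx0 => /eq_row_mx[A0 B0]; split.
    have b0 : 2 * beta != 0 by apply: lt0r_neq0; lra.
    by move/eqP: A0; rewrite scaler_eq0 (negPf b0) => /eqP.
  by rewrite -[B]trmxK -[B^T]opprK B0 oppr0 trmx0.
have trX := tr_gram_skew sX spX; have trY := tr_gram_skew sY spY.
have trXE : \tr (X^T *m X) = 4 * beta ^+ 2 * \tr (A^T *m A) + 2 * \tr (B^T *m B).
  rewrite /X /generator tr_block_mx mulmx_block mxtrace_block.
  have -> : (- B^T)^T = - B by apply/matrixP => i j; rewrite !mxE.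
  rewrite mulNmx mulmxN opprK !mulmx0 !addr0 mxtraceD.
  rewrite (mxtrace_mulC B) [X in _ = X]addrC; rewrite tr_gramZ.
  by ring.
have trYE : \tr (Y^T *m Y) = (2 * beta - 1) ^+ 2 * \tr (A^T *m A).
  exact: tr_gramZ.
have scale (I : finType) (f : I -> R) :
    \sum_i (f i / (2 * pi)) ^+ 2 = (\sum_i f i ^+ 2) / (2 * pi) ^+ 2.
  by rewrite mulr_suml; apply: eq_bigr => i _; rewrite expr_div_n.
move: gap; rewrite /h /y !scale -trX -trY trXE trYE /energy.
set a := \tr _; set b := \tr _.
have pp : 0 < (2 * pi) ^+ 2 :> R by rewrite exprn_gt0 //; lra.
rewrite -(ler_pM2r pp) mulrDl -!mulrA mulVf ?gt_eqF // !mulr1.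
have -> : (1 + (2 * beta - 1)^-1) * ((2 * beta - 1) * ((2 * beta - 1) * a)) =
    (2 * beta) * (2 * beta - 1) * a by field; lra.
lra.
Qed.
End LowerBound.

(** * Shortest loops *)

Section Loops.
Variables (R : realType) (p q : nat) (beta : R).
Local Notation C := R[i].
Local Notation toC := (map_mx (real_complex R)).

(** Each eigenvalue of [X] is 0 or a square root of [- (2 pi)^2], so its
    exponential is 1. *)
Lemma exp_mx_period m (X : 'M[R]_m) : skew_mx X ->
  X *m X *m X = - ((2 * pi) ^+ 2 *: X) -> exp_mx X = 1%:M.
Proof.
move=> /skew_spectrumP[P [t sp]] X3; have [uP XE] := sp.
have t3 k : t k * (t k ^+ 2 - (2 * pi) ^+ 2) = 0.
  have [uPc XcE] := skew_spectrumZ (- (2 * pi) ^+ 2) sp.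
  have e : spectral_mx P (fun k => imag (t k) * imag (t k) * imag (t k)) =
      spectral_mx P (fun k => imag (- (2 * pi) ^+ 2 * t k)).
    have X3C : toC X *m toC X *m toC X = toC (- (2 * pi) ^+ 2 *: X).
      by rewrite scaleNr -X3 map_mxM map_mxM.
    by rewrite -XcE -X3C XE (spectral_mxM uP) (spectral_mxM uP).
  have := spectral_mx_inj uP e k.
  rewrite /imag; simpc; case=> h; apply/eqP; rewrite -oppr_eq0; apply/eqP.
  by rewrite mulrBr -expr2 -exprSr in h *; lra.
apply: toC_inj; rewrite (exp_mx_spectrum sp) map_mx1 -(spectral_mx1 uP).
congr spectral_mx; apply/funext => k.
have pi2 : 2 * pi = pi *+ 2 :> R by rewrite mulr2n; ring.
move/eqP: (t3 k); rewrite mulf_eq0 subr_sqr mulf_eq0 subr_eq0 addr_eq0.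
move=> /or3P[] /eqP ->; rewrite ?cis0 // /cis pi2 ?cosN ?sinN cos2pi sin2pi //.
by rewrite oppr0.
Qed.

Lemma geodesic_at_InpZ (A : 'M[R]_p) (B : 'M[R]_(q, p)) T :
  geodesic_at_Inp beta (T *: A) (T *: B) 1 = geodesic_at_Inp beta A B T.
Proof.
have gE : generator beta (T *: A) (T *: B) = T *: generator beta A B.
  rewrite /generator scale_block_mx scaler0 !scalerA mulrC; congr block_mx.
  by apply/matrixP => i j; rewrite !mxE mulrN.
by rewrite !geodesic_at_InpE gE !scale1r !scalerA mulrC.
Qed.

Lemma energyZ (A : 'M[R]_p) (B : 'M[R]_(q, p)) T :
  energy beta (T *: A) (T *: B) = T ^+ 2 * energy beta A B.
Proof. by rewrite /energy !tr_gramZ; ring. Qed.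

(** Rescaling time to 1 turns the loop into one to which
    [closed_geodesic_energy] applies, with energy the square of its length. *)
Lemma geodesic_loop_length_ge g T : 1 / 2 < beta ->
  @geodesic_loop R p q beta g T -> 2 * pi <= riemannian_length beta g T.
Proof.
move=> hbeta [[U [D [sU tD [V UV gE]]]] T0 [t tT gt] gT].
have pi0 := pi_gt0 R.
set A := U^T *m D in gE; set B := V^T *m D in gE.
have sA : skew_mx A by exact: tD.
have oQ : orthogonal_mx (row_mx U V) by exact: UV.
rewrite gE in gt gT *; rewrite (length_geodesic beta B oQ sA T0).
have e : (2 * pi) ^+ 2 <= T ^+ 2 * energy beta A B.
  rewrite -energyZ; apply: (closed_geodesic_energy hbeta (skewZ T sA)).
  - rewrite geodesic_at_InpZ.
    move/(congr1 (mulmx (row_mx U V)^T)): gT.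
    by rewrite geodesic_at_Inp0 !mulmxA (oQ : _ = _) !mul1mx.
  - move=> [/eqP TA /eqP TB]; move: TA TB.
    rewrite !scaler_eq0 (gt_eqF T0) /= => /eqP A0 /eqP B0.
    have cst s : geodesic_at_Inp beta A B s = Inp R p q.
      rewrite -geodesic_at_InpZ A0 B0 !scaler0.
      rewrite -[0 in X in geodesic_at_Inp _ X](scale0r (0 : 'M[R]_p)).
      by rewrite -[X in geodesic_at_Inp _ _ X](scale0r 0) geodesic_at_InpZ geodesic_at_Inp0.
    by move/negP: gt; apply; rewrite !cst.
have -> : T * Num.sqrt (energy beta A B) = Num.sqrt (T ^+ 2 * energy beta A B).
  by rewrite sqrtrM ?sqr_ge0 // sqrtr_sqr gtr0_norm.
have -> : 2 * pi = Num.sqrt ((2 * pi) ^+ 2) :> R.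
  by rewrite sqrtr_sqr gtr0_norm //; lra.
exact: ler_wsqrtr.
Qed.

(** A full turn of the plane spanned by one basis vector of each block. *)
Lemma geodesic_loop_2pi (i0 : 'I_p) (j0 : 'I_q) :
  geodesic_loop_lengths p q beta (2 * pi).
Proof.
have pi0 := pi_gt0 R.
pose B : 'M[R]_(q, p) := (2 * pi) *: delta_mx j0 i0.
have sA : skew_mx (0 : 'M[R]_p) by rewrite /skew_mx trmx0 oppr0.
have trD : (delta_mx j0 i0 : 'M[R]_(q, p))^T = delta_mx i0 j0.
  by apply/matrixP => i j; rewrite !mxE andbC.
have energyE : energy beta 0 B = (2 * pi) ^+ 2.
  rewrite /energy mulmx0 mxtrace0 mulr0 add0r tr_gramZ trD mul_delta_mx.
  rewrite (_ : \tr _ = 1) ?mulr1 // /mxtrace (bigD1 i0) //= !mxE eqxx big1 ?addr0 // => i ne.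
  by rewrite mxE (negPf ne).
have closed : exp_mx (generator beta 0 B) = 1%:M.
  apply: exp_mx_period; first exact: skew_generator.
  have BBB : B *m B^T *m B = (2 * pi) ^+ 2 *: B.
    have -> : B^T = (2 * pi) *: delta_mx i0 j0 by rewrite -trD; apply/matrixP => i j; rewrite !mxE.
    rewrite /B -!(scalemxAl, scalemxAr) !mul_delta_mx.
    by rewrite !scalerA; congr (_ *: _); ring.
  have BBBt : B^T *m B *m B^T = (2 * pi) ^+ 2 *: B^T.
    by apply: trmx_inj; rewrite !trmx_mul !trmxK mulmxA BBB; apply/matrixP => i j; rewrite !mxE.
  rewrite /generator scaler0 !mulmx_block !mul0mx !mulmx0 !addr0 !add0r.
  rewrite scale_block_mx opp_block_mx !scaler0 oppr0 !(mulmxN, mulNmx) opprK BBB BBBt.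
  by rewrite scalerN opprK !mul0mx.
pose U := Inp R p q; pose V : 'M[R]_(p + q, q) := col_mx 0 1%:M.
have UV1 : row_mx U V = 1%:M by rewrite /U /V /Inp -block_mxEh -scalar_mx_block.
have oQ : orthogonal_mx (row_mx U V) by rewrite UV1 /orthogonal_mx trmx1 mulmx1.
pose D : 'M[R]_(p + q, p) := col_mx 0 B.
have UD : U^T *m D = 0.
  by rewrite /U /D /Inp tr_col_mx mul_row_col trmx0 mulmx0 mul0mx addr0.
have VD : V^T *m D = B.
  by rewrite /V /D tr_col_mx mul_row_col trmx0 mulmx0 add0r trmx1 mul1mx.
exists (fun t => row_mx U V *m geodesic_at_Inp beta 0 B t), 1; split; last first.
  rewrite (length_geodesic beta B oQ sA ltr01) energyE mul1r sqrtr_sqr gtr0_norm //; lra.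
split; [|exact: ltr01| |].
- exists U, D; split.
  + by rewrite /stiefel /U /Inp /= tr_col_mx mul_row_col trmx1 mulmx1 trmx0 mul0mx addr0.
  + by rewrite /tangent /= UD.
  + by exists V; [exact: oQ | rewrite UD VD].
- apply: nonconstant_geodesic => //; rewrite energyE exprn_gt0 //; lra.
- congr (_ *m _); rewrite geodesic_at_Inp0 geodesic_at_InpE scale1r closed.
  by rewrite !scaler0 exp_mx0 mul1mx mulmx1.
Qed.
End Loops.

Unset Implicit Arguments.
Set Strict Implicit.

Theorem theorem5p8 (R : realType) (n p : nat) (hp : (2 <= p)%N)
  (hpn : (p <= n - 1)%N) (beta : R) (hbeta : 2 < beta) :
  is_shortest_loop_length p (n - p) beta (2 * pi).
Proof.
split.
  apply: geodesic_loop_2pi; first by apply: (@Ordinal _ 0); lia.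
  by apply: (@Ordinal _ 0); lia.
move=> l [g [T [loop ->]]]; apply: geodesic_loop_length_ge loop; lra.
Qed.
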